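(* For every prime number $p$, there exist regular local rings $R$ of characteristic $p$ and of positive (Krull) dimension such that the $R$-module $F^e_*R$ is indecomposable for all $e\in\mathbb{N}$.
   Context: For a commutative ring $R$ of prime characteristic $p$, $F^e_*R$ denotes the $R$-module obtained from $R$ by restriction of scalars along the Frobenius map $F^e:R\to R$, $r\mapsto r^{p^e}$; i.e. as an abelian group it is $R$, and $r\in R$ acts by multiplication by $r^{p^e}$. A nonzero module is indecomposable if it is not a direct sum of two nonzero submodules. *)

(* Defs.v *)
From HB Require Import structures.
From mathcomp Require Import all_boot all_order all_algebra.

Set Implicit Arguments.
Unset Strict Implicit.
Unset Printing Implicit Defensive.

Import GRing.Theory.
Local Open Scope ring_scope.

(* Ideals and submodules are boolean predicates, as in ring_quotient and
   ssralg; classically (boolp.asbool) every subset is of this form.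
   [submod_closed] over [R^o] also allows the unit ideal, whereas
   [idealr_closed] requires 1 not to be a member. *)

Definition is_ideal (R : comNzRingType) (I : {pred R}) : Prop :=
  submod_closed (I : {pred R^o}).

Definition is_prime_ideal (R : comNzRingType) (P : {pred R}) : Prop :=
  idealr_closed P /\ prime_idealr_closed P.

Definition is_maximal_ideal (R : comNzRingType) (M : {pred R}) : Prop :=
  idealr_closed M /\
  forall I : {pred R}, idealr_closed I -> {subset M <= I} -> I =i M.

Definition generates (R : comNzRingType) (n : nat) (g : 'I_n -> R)
    (I : {pred R}) : Prop :=
  forall x : R, x \in I <-> exists c : 'I_n -> R, x = \sum_(i < n) c i * g i.

Definition noetherian (R : comNzRingType) : Prop :=
  forall I : {pred R}, is_ideal I ->
    exists (n : nat) (g : 'I_n -> R), generates g I.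

Definition min_generators (R : comNzRingType) (I : {pred R}) (n : nat) : Prop :=
  (exists g : 'I_n -> R, generates g I) /\
  (forall (m : nat) (g : 'I_m -> R), generates g I -> (n <= m)%N).

(* A strict chain P 0 < ... < P n of n + 1 primes; the values of P beyond n are
   irrelevant. *)
Definition prime_chain (R : comNzRingType) (n : nat) (P : nat -> {pred R}) :
    Prop :=
  (forall i : nat, (i <= n)%N -> is_prime_ideal (P i)) /\
  (forall i : nat, (i < n)%N ->
     {subset P i <= P i.+1} /\ ~ {subset P i.+1 <= P i}).

Definition krull_dim (R : comNzRingType) (d : nat) : Prop :=
  (exists P : nat -> {pred R}, prime_chain d P) /\
  (forall (n : nat) (P : nat -> {pred R}), prime_chain n P -> (n <= d)%N).

Definition local_with (R : comNzRingType) (M : {pred R}) : Prop :=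
  is_maximal_ideal M /\
  forall N : {pred R}, is_maximal_ideal N -> N =i M.

Definition regular_local_ring (R : comNzRingType) : Prop :=
  noetherian R /\
  exists (M : {pred R}) (d : nat),
    [/\ local_with M, krull_dim R d & min_generators M d].

Definition indecomposable (R : comNzRingType) (V : lmodType R) : Prop :=
  (exists v : V, v != 0) /\
  forall U W : {pred V}, submod_closed U -> submod_closed W ->
    (forall v : V, exists u w : V, [/\ u \in U, w \in W & v = u + w]) ->
    (forall v : V, v \in U -> v \in W -> v = 0) ->
    (forall u : V, u \in U -> u = 0) \/ (forall w : V, w \in W -> w = 0).

(* F^e_* R.  The proof that R has characteristic p is a parameter because the
   action is additive in the scalar only in characteristic p. *)
Definition frobenius_pushforward (R : comNzRingType) (p : nat)
  (chRp : p \in [pchar R]) (e : nat) : Type := R.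

Section FrobeniusPushforward.
Variables (R : comNzRingType) (p : nat) (chRp : p \in [pchar R]) (e : nat).
Local Notation F := (frobenius_pushforward chRp e).

HB.instance Definition _ := GRing.Zmodule.copy F R.

Definition frobenius_scale (r : R) (x : F) : F := r ^+ (p ^ e) * (x : R).

Lemma frobenius_scaleA (a b : R) (x : F) :
  frobenius_scale a (frobenius_scale b x) = frobenius_scale (a * b) x.
Proof. by rewrite /frobenius_scale exprMn mulrA. Qed.

Lemma frobenius_scale1 : left_id 1 frobenius_scale.
Proof. by move=> x; rewrite /frobenius_scale expr1n mul1r. Qed.

Lemma frobenius_scaleDr : right_distributive frobenius_scale +%R.
Proof. by move=> a x y; rewrite /frobenius_scale -mulrDr. Qed.

Lemma frobenius_scaleDl (x : F) :
  {morph frobenius_scale^~ x : a b / a + b}.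
Proof.
move=> a b; rewrite /frobenius_scale -[RHS]mulrDl exprDn_pchar //.
by rewrite pnatX pnatE ?(pcharf_prime chRp) // chRp.
Qed.

HB.instance Definition _ := GRing.Zmodule_isLmodule.Build R F
  frobenius_scaleA frobenius_scale1 frobenius_scaleDr frobenius_scaleDl.

Lemma frobenius_pushforward_scaleE (r : R) (x : F) :
  r *: x = (r ^+ (p ^ e) * (x : R) : R).
Proof. by []. Qed.

End FrobeniusPushforward.

(* Main.v *)
Require Import Defs.
From HB Require Import structures.
From mathcomp Require Import all_boot all_order all_algebra.
From mathcomp Require Import boolp zify ring.

(** Let f = sum_k t^(N_k) be a lacunary series over 'F_p and let R be the
    discrete valuation ring 'F_p(t, f) :&: 'F_p[[t]].  Put q = p^e.  An
    R^q-linear map phi : R -> R is determined by the phi(t^i) for i < q, by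
    t-adic continuity: if x_i is the part of x made of the monomials of degree
    congruent to i modulo q, then phi(x) = sum_i t^(-i) x_i phi(t^i).  If the
    N_k visit the residue classes modulo q suitably and grow fast enough, a
    Liouville argument shows that 1, f_1, ..., f_(q-1) are linearly independent
    over 'F_p(t, f).  Since f is the sum of the f_i, the formula for phi(f) then
    forces phi(t^i) = t^i phi(1), hence phi is the multiplication by phi(1).
    So the only endomorphisms of F^e_* R are the elements of R, and an
    idempotent of a domain is 0 or 1. *)

Set Implicit Arguments.
Unset Strict Implicit.
Unset Printing Implicit Defensive.

Import GRing.Theory.
Local Open Scope ring_scope.

(** * Formal power series *)

Record fps (F : fieldType) := Fps { fps_coef :> nat -> F }.

HB.instance Definition _ (F : fieldType) := gen_eqMixin (fps F).
HB.instance Definition _ (F : fieldType) := gen_choiceMixin (fps F).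

Lemma fpsP (F : fieldType) (x y : fps F) : x =1 y <-> x = y.
Proof.
split=> [|-> //]; case: x y => x [y] /= e; congr Fps; exact: funext.
Qed.

Section FpsRing.
Variable F : fieldType.
Implicit Types (x y z u v w : fps F) (P Q : {poly F}) (n : nat).

Definition fps_trunc n x : {poly F} := \poly_(i < n) x i.

Definition fps_zero : fps F := Fps (fun=> 0).
Definition fps_opp x : fps F := Fps (fun n => - x n).
Definition fps_add x y : fps F := Fps (fun n => x n + y n).

Definition fps_one : fps F := Fps (fun n => (n == 0%N)%:R).
(** Multiplying truncations lets the ring axioms be inherited from [{poly F}]. *)
Definition fps_mul x y : fps F :=
  Fps (fun n => (fps_trunc n.+1 x * fps_trunc n.+1 y)`_n).

Fact fps_addA : associative fps_add.
Proof. by move=> x y z; apply/fpsP => n; rewrite /= addrA. Qed.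
Fact fps_addC : commutative fps_add.
Proof. by move=> x y; apply/fpsP => n; rewrite /= addrC. Qed.
Fact fps_add0 : left_id fps_zero fps_add.
Proof. by move=> x; apply/fpsP => n; rewrite /= add0r. Qed.
Fact fps_addN : left_inverse fps_zero fps_opp fps_add.
Proof. by move=> x; apply/fpsP => n; rewrite /= addNr. Qed.

HB.instance Definition _ := GRing.isZmodule.Build (fps F)
  fps_addA fps_addC fps_add0 fps_addN.

Lemma fps_coefD x y n : (x + y) n = x n + y n. Proof. by []. Qed.
Lemma fps_coefN x n : (- x) n = - x n. Proof. by []. Qed.

Lemma coef_fps_trunc n x i : (i < n)%N -> (fps_trunc n x)`_i = x i.
Proof. by rewrite coef_poly => ->. Qed.

(** Each coefficient of a product depends only on coefficients of no larger degree, so any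
    polynomials that agree with the factors far enough may replace the truncations. *)
Lemma coefM_agree P Q x y n :
    (forall i, (i <= n)%N -> P`_i = x i) ->
    (forall i, (i <= n)%N -> Q`_i = y i) ->
  (P * Q)`_n = fps_mul x y n.
Proof.
move=> Px Qy; rewrite /= !coefM; apply: eq_bigr => i _.
have le_in : (i <= n)%N by rewrite -ltnS.
by rewrite !coef_fps_trunc ?ltnS ?leq_subr // Px ?Qy ?leq_subr.
Qed.

Lemma coef_fps_truncM n x y i : (i < n)%N ->
  (fps_trunc n x * fps_trunc n y)`_i = fps_mul x y i.
Proof.
by move=> lt_in; apply: coefM_agree => j le_ji;
   rewrite coef_fps_trunc // (leq_ltn_trans le_ji).
Qed.

Fact fps_mulA : associative fps_mul.
Proof.
move=> x y z; apply/fpsP => n.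
rewrite -(@coefM_agree (fps_trunc n.+1 x)
  (fps_trunc n.+1 y * fps_trunc n.+1 z)).
- by rewrite mulrA; apply: coefM_agree => i le_in;
     rewrite ?coef_fps_truncM ?coef_fps_trunc.
- by move=> i le_in; rewrite coef_fps_trunc.
by move=> i le_in; rewrite coef_fps_truncM.
Qed.

Fact fps_mulC : commutative fps_mul.
Proof. by move=> x y; apply/fpsP => n; rewrite /= mulrC. Qed.

Fact fps_mul1 : left_id fps_one fps_mul.
Proof.
move=> x; apply/fpsP => n.
rewrite -(@coefM_agree 1 (fps_trunc n.+1 x)) ?mul1r ?coef_fps_trunc //.
- by move=> i _; rewrite coef1.
by move=> i le_in; rewrite coef_fps_trunc.
Qed.

Fact fps_mulDl : left_distributive fps_mul fps_add.
Proof.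
move=> x y z; apply/fpsP => n.
rewrite -(@coefM_agree (fps_trunc n.+1 x + fps_trunc n.+1 y)
  (fps_trunc n.+1 z)).
- by rewrite mulrDl coefD.
- by move=> i le_in; rewrite coefD !coef_fps_trunc.
by move=> i le_in; rewrite coef_fps_trunc.
Qed.

Fact fps_one_neq0 : fps_one != 0.
Proof. by apply/eqP => /fpsP/(_ 0%N)/eqP; rewrite oner_eq0. Qed.

HB.instance Definition _ := GRing.Zmodule_isComNzRing.Build (fps F)
  fps_mulA fps_mulC fps_mul1 fps_mulDl fps_one_neq0.

Lemma fps_coefM x y n : (x * y) n = \sum_(i < n.+1) x i * y (n - i)%N.
Proof.
rewrite -[LHS]/((fps_trunc n.+1 x * fps_trunc n.+1 y)`_n) coefM.
apply: eq_bigr => i _.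
by rewrite !coef_fps_trunc // ltnS leq_subr.
Qed.

Lemma fps_coef_sum (I : Type) (r : seq I) (p : pred I) (G : I -> fps F) n :
  (\sum_(i <- r | p i) G i) n = \sum_(i <- r | p i) G i n.
Proof. exact: (big_morph (fun x : fps F => x n)). Qed.

Definition fps_poly P : fps F := Fps (fun n => P`_n).

Fact fps_poly_is_zmod_morphism : zmod_morphism fps_poly.
Proof. by move=> P Q; apply/fpsP => n; rewrite /= coefB. Qed.

Fact fps_poly_is_monoid_morphism : monoid_morphism fps_poly.
Proof.
split=> [|P Q]; apply/fpsP => n; first by rewrite /= coef1.
exact: (@coefM_agree P Q (fps_poly P) (fps_poly Q)).
Qed.

HB.instance Definition _ := GRing.isZmodMorphism.Build _ _ fps_poly
  fps_poly_is_zmod_morphism.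
HB.instance Definition _ := GRing.isMonoidMorphism.Build _ _ fps_poly
  fps_poly_is_monoid_morphism.

Definition eqmod n x y := forall i, (i < n)%N -> x i = y i.

Lemma eqmod_sym n x y : eqmod n x y -> eqmod n y x.
Proof. by move=> h i /h. Qed.

Lemma eqmod_trans n y x z : eqmod n x y -> eqmod n y z -> eqmod n x z.
Proof. by move=> xy yz i lt_in; rewrite xy ?yz. Qed.

Lemma eqmodW m n x y : (m <= n)%N -> eqmod n x y -> eqmod m x y.
Proof. by move=> le_mn xy i lt_im; apply/xy/(leq_trans lt_im). Qed.

Lemma eqmodD n x y x' y' :
  eqmod n x x' -> eqmod n y y' -> eqmod n (x + y) (x' + y').
Proof. by move=> xx yy i lt_in; rewrite !fps_coefD xx ?yy. Qed.

Lemma eqmodM n x y x' y' :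
  eqmod n x x' -> eqmod n y y' -> eqmod n (x * y) (x' * y').
Proof.
move=> xx yy i lt_in; rewrite !fps_coefM; apply: eq_bigr => j _.
rewrite xx ?yy //; first exact: leq_ltn_trans (leq_subr _ _) lt_in.
by apply: leq_ltn_trans lt_in; rewrite -ltnS.
Qed.

Lemma eqmod_sum n (I : Type) (r : seq I) (p : pred I) (G H : I -> fps F) :
    (forall i, eqmod n (G i) (H i)) ->
  eqmod n (\sum_(i <- r | p i) G i) (\sum_(i <- r | p i) H i).
Proof.
move=> GH; by apply: (big_ind2 (eqmod n)) => // *; apply: eqmodD.
Qed.

Lemma eqmod_horner n (P : {poly fps F}) x y :
  eqmod n x y -> eqmod n P.[x] P.[y].
Proof.
move=> xy; elim/poly_ind: P => [|P c IH]; first by rewrite !horner0.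
by rewrite !hornerE; apply: eqmodD => //; apply: eqmodM.
Qed.

Lemma eqmod_eq x y : (forall n, eqmod n x y) -> x = y.
Proof. by move=> xy; apply/fpsP => n; apply: (xy n.+1). Qed.

Lemma eqmod_fps_trunc n x : eqmod n (fps_poly (fps_trunc n x)) x.
Proof. by move=> i; apply: coef_fps_trunc. Qed.

Definition fps_t : fps F := fps_poly 'X.

Lemma fps_tXE n : fps_t ^+ n = fps_poly 'X^n.
Proof. by rewrite rmorphXn. Qed.

Lemma coef_tXM n x m :
  (fps_t ^+ n * x) m = if (m < n)%N then 0 else x (m - n)%N.
Proof.
transitivity ('X^n * fps_trunc m.+1 x)`_m.
  rewrite fps_tXE; apply/esym/(@coefM_agree _ _ (fps_poly 'X^n) x) => // i ?.
  by rewrite coef_fps_trunc.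
by rewrite coefXnM coef_fps_trunc // ltnS leq_subr.
Qed.

Lemma eqmod_tXM n x : eqmod n (fps_t ^+ n * x) 0.
Proof. by move=> i lt_in; rewrite coef_tXM lt_in. Qed.

Lemma eqmod_div_tX n x y : eqmod n x y -> exists z, x = y + fps_t ^+ n * z.
Proof.
move=> xy; exists (Fps (fun m => (x - y) (m + n)%N)); apply/fpsP => m.
rewrite fps_coefD coef_tXM; case: ltnP => [/xy->|le_nm]; first by rewrite addr0.
by rewrite /= subnK // addrC subrK.
Qed.

Lemma tX_inj n : injective (fun x => fps_t ^+ n * x).
Proof.
move=> x y /fpsP xy; apply/fpsP => m; have := xy (m + n)%N.
by rewrite !coef_tXM ltnNge leq_addl addnK.
Qed.

Lemma fps_factor x : x != 0 -> exists n u, x = fps_t ^+ n * u /\ u 0%N != 0.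
Proof.
move=> x0; have ex : exists n, x n != 0.
  apply: contrapT => h; case/eqP: x0; apply/fpsP => n; apply/eqP.
  by apply/negPn/negP => xn; apply: h; exists n.
have [n xn min] := ex_minnP ex.
have : eqmod n x 0.
  move=> i lt_in; apply/eqP/negPn/negP => /min; by rewrite leqNgt lt_in.
case/eqmod_div_tX => u; rewrite add0r => xu; exists n, u; split => //.
by move: xn; rewrite xu coef_tXM ltnn subnn.
Qed.

Lemma eqmod_expr0 n x : x 0%N = 0 -> eqmod n (x ^+ n) 0.
Proof.
move=> x0; have : eqmod 1 x 0 by case.
case/eqmod_div_tX => z; rewrite add0r expr1 => ->.
by rewrite exprMn; apply: eqmod_tXM.
Qed.

Lemma fps_inv u : u 0%N != 0 -> exists v, u * v = 1.
Proof.
(* The constant [c] normalizes [u]: [c * u = 1 - w] with [w] of zero constant term, so the inverse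
   is [c] times the geometric series in [w]. *)
move=> u0; set c := fps_poly ((u 0%N)^-1)%:P; set w : fps F := 1 - c * u.
have w0 : w 0%N = 0.
  by rewrite fps_coefD fps_coefN fps_coefM big_ord1 /= coefC mulVf ?subrr.
pose S n : fps F := \sum_(j < n) w ^+ j.
(* Coefficient [n] can be read off a partial sum, since [w ^+ j] has no term of degree [n] once
   [j > n]. *)
pose v := Fps (fun n => S n.+1 n).
have vS n : eqmod n v (S n).
  elim: n => [|n IH] i; first by [].
  rewrite ltnS leq_eqVlt => /orP[/eqP-> //|lt_in].
  rewrite (IH i) // /S big_ord_recr fps_coefD /=.
  by rewrite (eqmod_expr0 w0 lt_in) addr0.
exists (c * v); rewrite mulrA [u * c]mulrC; apply: eqmod_eq => n.
apply: (@eqmod_trans n (c * u * S n)); first exact: eqmodM.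
have -> : c * u = 1 - w by rewrite /w subKr.
have geom z : (1 - z) * \sum_(j < n) z ^+ j = 1 - z ^+ n.
  by rewrite -(opprB z) mulNr -subrX1 opprB.
rewrite geom => i lt_in.
rewrite fps_coefD fps_coefN (eqmod_expr0 w0 lt_in).
by rewrite subr0.
Qed.

Lemma fps_integral x y : x * y = 0 -> x = 0 \/ y = 0.
Proof.
have [->|x0] := eqVneq x 0; first by left.
have [n [u [-> /fps_inv[v uv]]]] := fps_factor x0.
rewrite -mulrA => xy0; right.
have : u * y = 0 by apply: (@tX_inj n); rewrite xy0 mulr0.
by move/(congr1 ( *%R v)); rewrite mulr0 mulrA [v * u]mulrC uv mul1r.
Qed.

End FpsRing.

(** * Discrete valuation rings *)

Section DiscreteValuationRing.
Variables (R : comNzRingType) (t : R).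
Hypothesis integral : forall x y : R, x * y = 0 -> x = 0 \/ y = 0.
Hypothesis t_neq0 : t != 0.
Hypothesis t_nonunit : forall x : R, t * x != 1.
Hypothesis factor : forall x : R, x != 0 ->
  exists n u v, x = t ^+ n * u /\ u * v = 1.

Lemma dvr_tX_in (I : {pred R}) (x : R) : is_ideal I -> x \in I -> x != 0 ->
  exists n u, x = t ^+ n * u /\ t ^+ n \in I.
Proof.
move=> [I0 Ilin] xI /factor[n [u [v [xE uv]]]]; exists n, u; split=> //.
have := Ilin v x 0 xI I0.
by rewrite addr0 xE /GRing.scale /= mulrC -mulrA uv mulr1.
Qed.

(** A nonzero ideal is generated by the least power of [t] that it contains. *)
Lemma dvr_principal (I : {pred R}) : is_ideal I ->
  exists g, forall x, x \in I <-> exists c, x = c * g.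
Proof.
move=> idI; have [I0 Ilin] := idI.
have IM c g : g \in I -> c * g \in I.
  by move=> gI; have := Ilin c g 0 gI I0; rewrite addr0.
have [[x [xI x0]]|I_0] := pselect (exists x, x \in I /\ x != 0); last first.
  exists 0 => x; split=> [xI|[c ->]]; last by rewrite mulr0.
  by exists 0; rewrite mulr0; apply: contrapT => /eqP x0; apply: I_0; exists x.
have ex : exists n, t ^+ n \in I.
  by have [n [u [_ nI]]] := dvr_tX_in idI xI x0; exists n.
have [n nI min] := ex_minnP ex.
exists (t ^+ n) => y; split=> [yI|[c ->]]; last exact: IM.
have [->|y0] := eqVneq y 0; first by exists 0; rewrite mul0r.
have [m [u [-> mI]]] := dvr_tX_in idI yI y0.
by exists (t ^+ (m - n) * u); rewrite mulrAC -exprD subnK ?min.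
Qed.

Lemma dvr_noetherian : noetherian R.
Proof.
move=> I /dvr_principal[g gP]; exists 1%N, (fun=> g) => x.
rewrite gP; split=> [[c ->]|[c ->]]; last by exists (c ord0); rewrite big_ord1.
by exists (fun=> c); rewrite big_ord1.
Qed.

Definition dvr_max : {pred R} := fun x => `[< exists y, x = t * y >].

Lemma dvr_maxP (x : R) : reflect (exists y, x = t * y) (x \in dvr_max).
Proof. exact: asboolP. Qed.

Lemma dvr_t_max : t \in dvr_max.
Proof. by apply/dvr_maxP; exists 1; rewrite mulr1. Qed.

Lemma dvr_unit (x : R) : x \notin dvr_max -> exists v, x * v = 1.
Proof.
move=> xM; have x0 : x != 0.
  by apply: contraNneq xM => ->; apply/dvr_maxP; exists 0; rewrite mulr0.
have [[|n] [u [v [xE uv]]]] := factor x0; last first.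
  by case/negP: xM; apply/dvr_maxP; exists (t ^+ n * u); rewrite mulrA -exprS.
by exists v; rewrite xE expr0 mul1r.
Qed.

Lemma dvr_max_closed : idealr_closed dvr_max.
Proof.
split=> [||a _ _ /dvr_maxP[x ->] /dvr_maxP[y ->]].
- by apply/dvr_maxP; exists 0; rewrite mulr0.
- by apply/dvr_maxP => -[y /esym/eqP]; apply/negP.
by apply/dvr_maxP; exists (a * x + y); rewrite mulrDr mulrCA.
Qed.

Lemma dvr_sub_max (I : {pred R}) : idealr_closed I -> {subset I <= dvr_max}.
Proof.
move=> [I0 I1 Ilin] x xI; apply: contraNT I1 => /dvr_unit[v xv].
by have := Ilin v x 0 xI I0; rewrite addr0 mulrC xv.
Qed.

Lemma dvr_local : local_with dvr_max.
Proof.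
split=> [|N [idN maxN]].
  split=> [|I idI sMI x]; first exact: dvr_max_closed.
  by apply/idP/idP => [/(dvr_sub_max idI)|/sMI].
by move=> x; rewrite (maxN _ dvr_max_closed (dvr_sub_max idN)).
Qed.

Lemma dvr_max_prime : is_prime_ideal dvr_max.
Proof.
split=> [|x y]; first exact: dvr_max_closed.
move=> xyM; have [//|/dvr_unit[v xv]] := boolP (x \in dvr_max).
have [_ _ lin] := dvr_max_closed; have [M0 _ _] := dvr_max_closed.
by have := lin v _ 0 xyM M0; rewrite addr0 mulrA [v * x]mulrC xv mul1r.
Qed.

(** Up to a unit, [x] is a power of [t]; this power lies in [P], hence so does [t] by primality. *)
Lemma dvr_prime_eq_max (P : {pred R}) (x : R) : is_prime_ideal P ->
  x \in P -> x != 0 -> {subset dvr_max <= P}.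
Proof.
move=> [idP primeP] xP x0 _ /dvr_maxP[y ->]; have [P0 P1 lin] := idP.
have idealP : is_ideal P by split.
have [n [u [_ nP]]] := dvr_tX_in idealP xP x0.
have tP : t \in P.
  elim: n nP => [|n IH]; first by rewrite expr0 (negPf P1).
  by rewrite exprS => /primeP/orP[].
by have := lin y t 0 tP P0; rewrite addr0 mulrC.
Qed.

Lemma dvr_krull_dim : krull_dim R 1.
Proof.
split=> [|n P [primeP chainP]].
  exists (fun i => if i is 0%N then pred1 0 : {pred R} else dvr_max); split.
    case=> [|i] _; last exact: dvr_max_prime.
    split=> [|x y]; first split=> [||a x y]; rewrite ?inE ?oner_eq0 //.
      by move=> /eqP-> /eqP->; rewrite mulr0 addr0.
    by move=> /eqP/integral[]->; rewrite eqxx ?orbT.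
  case=> // _; split=> [x|/(_ t dvr_t_max)].
    by rewrite inE => /eqP->; have [] := dvr_max_closed.
  by rewrite inE (negPf t_neq0).
rewrite leqNgt; apply/negP => n_gt1.
(* A nonzero element of [P 1] would force [P 1] to contain [dvr_max], hence [P 2]; without one,
   [P 1] would lie in [P 0]. *)
have [P01 P10] := chainP 0%N (ltnW n_gt1); have [_ P21] := chainP 1%N n_gt1.
have [[P0 _ _] _] := primeP 0%N (leq0n n).
apply: P10 => x xP1; have [-> //|x0] := eqVneq x 0; case: P21 => y yP2.
apply: dvr_prime_eq_max (primeP 1%N (ltnW n_gt1)) xP1 x0 _ _.
by have [idP2 _] := primeP 2%N n_gt1; apply: dvr_sub_max idP2 _ yP2.
Qed.

Lemma dvr_regular_local : regular_local_ring R.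
Proof.
split; first exact: dvr_noetherian.
exists dvr_max, 1%N; split; [exact: dvr_local|exact: dvr_krull_dim|split].
  exists (fun=> t) => x; split=> [/dvr_maxP[y ->]|[c ->]].
    by exists (fun=> y); rewrite big_ord1 mulrC.
  by rewrite big_ord1; apply/dvr_maxP; exists (c ord0); rewrite mulrC.
(* An ideal with no generators is zero, but [t] is in this one. *)
move=> [|m] // g /(_ t)[/(_ dvr_t_max)[c]].
by rewrite big_ord0 => /eqP; rewrite (negPf t_neq0).
Qed.

End DiscreteValuationRing.

(** * A lacunary series *)

Section ResidueSections.
Variables (F : fieldType) (q : nat).
Implicit Types (x y : fps F).

(** This is the component x_i of the expansion of phi. It is taken among all power series because it
    may leave the ring R. *)
Definition fps_sect (i : nat) x : fps F :=
  Fps (fun n => if (n %% q)%N == i then x n else 0).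

Lemma fps_sectD i x y : fps_sect i (x + y) = fps_sect i x + fps_sect i y.
Proof.
by apply/fpsP => n; rewrite fps_coefD /=; case: ifP; rewrite ?addr0.
Qed.

Lemma eqmod_sect n i x y :
  eqmod n x y -> eqmod n (fps_sect i x) (fps_sect i y).
Proof. by move=> xy m /xy /= ->. Qed.

Lemma sum_fps_sect x : (0 < q)%N -> \sum_(i < q) fps_sect i x = x.
Proof.
move=> q0; apply/fpsP => n; rewrite fps_coef_sum /=.
rewrite (bigD1 (Ordinal (ltn_pmod n q0))) //= eqxx big1 ?addr0 // => i.
by rewrite -val_eqE /= eq_sym => /negPf->.
Qed.

End ResidueSections.

(* The term [logn 2 k.+1] is the residue of the k-th exponent modulo p^e, once
   k >= e.  It takes every value infinitely often, and the neighbours of a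
   positive value are 0. *)
Fixpoint liouville_exp (p k : nat) : nat :=
  if k is k'.+1 then
    (p ^ k * (k * (liouville_exp p k' + 2)) + logn 2 k.+1)%N
  else 0%N.

Section LiouvilleExponents.
Variable p : nat.
Local Notation expo := (liouville_exp p).
Hypothesis p_gt0 : (0 < p)%N.

(** The next exponent eventually exceeds every fixed multiple of [expo k + 2]; this gap drives
    Liouville's argument. *)
Lemma liouville_exp_growth k : (k.+1 * (expo k + 2) <= expo k.+1)%N.
Proof.
rewrite [expo k.+1]/= -[X in (X <= _)%N]addn0 leq_add //.
by rewrite leq_pmull ?expn_gt0 ?p_gt0.
Qed.

Lemma liouville_exp_ltS k : (expo k < expo k.+1)%N.
Proof. by apply: leq_trans (liouville_exp_growth k); nia. Qed.

Lemma liouville_exp_mono : {mono expo : m n / (m <= n)%N}.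
Proof. by apply: leq_mono; apply: homo_ltn ltn_trans liouville_exp_ltS. Qed.

Lemma leq_liouville_exp k : (k <= expo k)%N.
Proof. by elim: k => // k IH; apply: leq_ltn_trans IH (liouville_exp_ltS k). Qed.

(** For positive [k], the factor [p ^ k] is divisible by [p ^ e], so only the added term survives;
    at [k = 0] both sides are 0. *)
Lemma liouville_exp_mod e k : (e <= k)%N -> expo k = logn 2 k.+1 %[mod p ^ e].
Proof.
case: k => // k le_ek; rewrite [expo _]/= -(subnK le_ek) expnD.
by rewrite -mulnA mulnCA -modnDml modnMr add0n subnK.
Qed.

End LiouvilleExponents.

(** Write P = P' X + c. Then P'(s) s = -c, where s has larger degree than c, so both sides vanish
    and the induction continues with P'. *)
Lemma root_size_gt (F : fieldType) (P : {poly {poly F}}) (s : {poly F})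
    (m : nat) :
    (forall j : nat, (size (P`_j)%R <= m)%N) -> (m < size s)%N -> P.[s] = 0 ->
  P = 0.
Proof.
move=> szP lt_ms; elim/poly_ind: P szP => [//|P c IH] szP.
have szc : (size c <= m)%N.
  by have := szP 0%N; rewrite coefD coefMX coefC eqxx add0r.
have szP' j : (size (P`_j)%R <= m)%N.
  by have := szP j.+1; rewrite coefD coefMX coefC addr0.
rewrite !hornerE => /eqP; rewrite addr_eq0 => /eqP Ps.
have Ps0 : P.[s] = 0.
  apply: contraTeq lt_ms => Ps_neq0; rewrite -leqNgt; apply: leq_trans szc.
  have [-> |s0] := eqVneq s 0; first by rewrite size_poly0.
  rewrite -(size_polyN c) -Ps size_mul // -ltnS prednK ?addn_gt0.
    by rewrite -add1n leq_add // size_poly_gt0.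
  by rewrite size_poly_gt0 Ps_neq0.
move/eqP: Ps; rewrite Ps0 mul0r eq_sym oppr_eq0 => /eqP ->.
by rewrite (IH szP' Ps0) mul0r addr0.
Qed.

(** * Degree bounds linear in the exponents *)

Section LinearBound.
Variables (F : fieldType) (p : nat).
Implicit Types g h : nat -> {poly F}.
Local Notation expo := (liouville_exp p).

(** The [+ 2] leaves room for constant terms even where [expo k] is 0. *)
Definition lbounded h :=
  exists D, forall k, (size (h k) <= D * (expo k + 2))%N.

Lemma lboundedC (c : {poly F}) : lbounded (fun=> c).
Proof. by exists (size c) => k; nia. Qed.

Lemma lboundedD g h : lbounded g -> lbounded h -> lbounded (g \+ h).
Proof.
move=> [D gD] [E hE]; exists (D + E)%N => k; have := size_polyD (g k) (h k).
by have := gD k; have := hE k; rewrite /=; nia.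
Qed.

Lemma lboundedM g h : lbounded g -> lbounded h -> lbounded (g \* h).
Proof.
move=> [D gD] [E hE]; exists (D + E)%N => k; have := size_polyMleq (g k) (h k).
by have := gD k; have := hE k; rewrite /=; nia.
Qed.

Lemma lbounded_sum (I : Type) (r : seq I) (c : pred I)
    (h : I -> nat -> {poly F}) :
    (forall i, lbounded (h i)) ->
  lbounded (fun k => \sum_(i <- r | c i) h i k).
Proof.
move=> hb; elim: r => [|i r [D IH]].
  by exists 0%N => k; rewrite big_nil size_poly0.
have [E hE] := hb i.
exists (E + D)%N => k; rewrite big_cons; have := IH k; have := hE k.
set s := \sum_(_ <- _ | _) _; have := size_polyD (h i k) s.
by case: ifP => _; nia.
Qed.

Hypothesis p_gt0 : (0 < p)%N.

Definition liouville_sum k : {poly F} := \sum_(j < k) 'X^(expo j).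
Definition liouville_sect q i k : {poly F} :=
  \sum_(j < k | (expo j %% q)%N == i) 'X^(expo j).

Lemma size_sum_liouville_exp (c : pred nat) k :
  (size (\sum_(j < k | c j) 'X^(expo j) : {poly F})%R <= expo k)%N.
Proof.
apply: leq_trans (size_sum _ _ _) _; apply/bigmax_leqP => j _.
rewrite size_polyXn; apply: leq_trans (liouville_exp_ltS p_gt0 _) _.
by rewrite (liouville_exp_mono p_gt0) ltn_ord.
Qed.

Lemma size_psum k : (size (liouville_sum k) <= expo k)%N.
Proof. exact: (size_sum_liouville_exp predT). Qed.

Lemma size_psumS k : size (liouville_sum k.+1) = (expo k).+1.
Proof.
rewrite /liouville_sum big_ord_recr /= addrC size_polyDl size_polyXn // ltnS.
exact: size_psum.
Qed.

Lemma lbounded_psum : lbounded (fun k => liouville_sum k.+1).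
Proof. by exists 1%N => k; rewrite size_psumS; lia. Qed.

Lemma lbounded_psect q i : lbounded (fun k => liouville_sect q i k.+1).
Proof.
exists 1%N => k; rewrite /liouville_sect.
apply: leq_trans (size_sum _ _ _) _; apply/bigmax_leqP => j _.
have : (expo j <= expo k)%N by rewrite (liouville_exp_mono p_gt0) -ltnS.
rewrite size_polyXn.
by lia.
Qed.

Lemma lbounded_horner (P : {poly {poly F}}) :
  lbounded (fun k => P.[liouville_sum k.+1]).
Proof.
elim/poly_ind: P => [|P c IH].
  by exists 0%N => k; rewrite horner0 size_poly0.
have [D PD] := lboundedD (lboundedM IH lbounded_psum) (lboundedC c).
by exists D => k; rewrite !hornerE; apply: PD.
Qed.

End LinearBound.

(** * The lacunary series and the independence of its sections *)

Section Liouville.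
Variables (F : fieldType) (p : nat).
Hypothesis p_pr : prime p.
Let p_gt0 := prime_gt0 p_pr.
Local Notation expo := (liouville_exp p).
Local Notation psum := (liouville_sum F p).
Local Notation psect := (liouville_sect F p).

(** The partial sum [psum n.+1] already has the final coefficient [n], since all later monomials
    have degree at least [expo n.+1 > n]. *)
Definition liouville : fps F := Fps (fun n => (psum n.+1)`_n).

(** The element P of F[t][Y] is evaluated at Y = f. *)
Definition liouville_eval (P : {poly {poly F}}) : fps F :=
  (map_poly (@fps_poly F) P).[liouville].

Fact liouville_eval_zmod : zmod_morphism liouville_eval.
Proof. by move=> P Q; rewrite /liouville_eval rmorphB hornerD hornerN. Qed.

Fact liouville_eval_monoid : monoid_morphism liouville_eval.
Proof.
by split=> [|P Q]; rewrite /liouville_eval ?rmorph1 ?hornerC // rmorphM hornerM.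
Qed.

HB.instance Definition _ := GRing.isZmodMorphism.Build _ _ liouville_eval
  liouville_eval_zmod.
HB.instance Definition _ := GRing.isMonoidMorphism.Build _ _ liouville_eval
  liouville_eval_monoid.

Lemma coef_psum k l n : (k <= l)%N -> (n < expo k)%N ->
  (psum l)`_n = (psum k)`_n.
Proof.
move=> le_kl lt_nk; elim: l le_kl => [|l IH]; first by rewrite leqn0 => /eqP->.
rewrite leq_eqVlt => /orP[/eqP-> //|]; rewrite ltnS => le_kl.
rewrite /liouville_sum big_ord_recr coefD coefXn /= -/(psum l) IH //.
have /ltn_eqF-> : (n < expo l)%N.
  by apply: leq_trans lt_nk _; rewrite (liouville_exp_mono p_gt0).
by rewrite addr0.
Qed.

Lemma eqmod_liouville k : eqmod (expo k) liouville (fps_poly (psum k)).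
Proof.
move=> n lt_nk /=; have lt_nn : (n < expo n.+1)%N by apply: leq_liouville_exp.
by case: (leqP k n.+1) => [le_kn|/ltnW le_nk];
   [apply: coef_psum | rewrite (coef_psum le_nk)].
Qed.

Lemma fps_sect_psum q i k :
  fps_sect q i (fps_poly (psum k)) = fps_poly (psect q i k).
Proof.
apply/fpsP => n /=; rewrite /liouville_sum /liouville_sect !coef_sum.
rewrite [RHS]big_mkcond.
case: ifP => n_i; last first.
  rewrite big1 // => j _; case: ifP => // j_i; rewrite coefXn.
  by case: eqP => // n_j; rewrite n_j j_i in n_i.
apply: eq_bigr => j _; rewrite coefXn.
by case: eqP => [<-|_]; rewrite ?n_i //; case: ifP.
Qed.

Lemma eqmod_eval k P :
  eqmod (expo k) (liouville_eval P) (fps_poly P.[psum k]).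
Proof. by rewrite -horner_map; apply/eqmod_horner/eqmod_liouville. Qed.

Section Independence.
Variables (e : nat) (P0 : {poly {poly F}}).
Local Notation q := (p ^ e)%N.
Variable P : 'I_q -> {poly {poly F}}.

(* In the relation [rel] below, only the sections of f are truncated; f itself
   remains the variable. *)
Let Q k : {poly {poly F}} :=
  P0 + \sum_(i < q | i != 0%N :> nat) psect q i k *: P i.

Let size_polyD_leq (A B : {poly F}) : (size (A + B)%R <= size A + size B)%N.
Proof. by apply: leq_trans (size_polyD A B) _; lia. Qed.

Let horner_Q k s :
  (Q k).[s] = P0.[s] + \sum_(i < q | i != 0%N :> nat) psect q i k * (P i).[s].
Proof.
rewrite hornerD horner_sum; congr (_ + _).
by apply: eq_bigr => i _; rewrite hornerZ.
Qed.

(** The monomial of degree [expo k] falls in section 0, which does not occur in [Q]. *)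
Let Q_recr k : logn 2 k.+1 = 0%N -> (e <= k)%N -> Q k.+1 = Q k.
Proof.
move=> r0 le_ek; congr (_ + _); apply: eq_bigr => i i0; congr (_ *: _).
rewrite /liouville_sect big_mkcond big_ord_recr /= -big_mkcond /=.
by rewrite liouville_exp_mod // r0 mod0n eq_sym (negPf i0) addr0.
Qed.

Hypothesis rel : liouville_eval P0 +
  \sum_(i < q | i != 0%N :> nat) liouville_eval (P i) * fps_sect q i liouville
  = 0.

(** Replacing f and its sections by their partial sums in [rel] only changes coefficients of degree
    at least [expo k]. *)
Let eqmod_Q k : eqmod (expo k) (fps_poly (Q k).[psum k]) 0.
Proof.
rewrite -rel horner_Q rmorphD rmorph_sum /=; apply/eqmod_sym/eqmodD.
  exact: eqmod_eval.
apply: eqmod_sum => i; rewrite rmorphM mulrC /=; apply: eqmodM.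
  by rewrite -fps_sect_psum; apply/eqmod_sect/eqmod_liouville.
exact: eqmod_eval.
Qed.

(* Liouville's argument: this polynomial vanishes modulo t^(expo k.+1), while
   its degree is at most a fixed multiple of [expo k]. *)
Let Q_psum : exists k0, forall k, (k0 <= k)%N -> (Q k.+1).[psum k.+1] = 0.
Proof.
have [D HD] : lbounded p (fun k => (Q k.+1).[psum k.+1]).
  have lbP (i : 'I_q) :
      lbounded p (fun k => psect q i k.+1 * (P i).[psum k.+1]).
    exact: (lboundedM (lbounded_psect F p_gt0 q i) (lbounded_horner p_gt0 _)).
  have [D HD] := lboundedD (lbounded_horner p_gt0 P0)
    (lbounded_sum (index_enum _) (fun i : 'I_q => i != 0%N :> nat) lbP).
  by exists D => k; rewrite horner_Q; apply: HD.
exists D => k le_Dk; apply/polyP => n; rewrite coef0.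
have [le_n|lt_n] := leqP (expo k.+1) n; last exact: (@eqmod_Q k.+1 n).
apply: nth_default; apply: leq_trans (HD k) _; apply: leq_trans le_n.
apply: leq_trans (liouville_exp_growth p_gt0 k).
by rewrite leq_mul2r ltnW ?ltnS ?orbT.
Qed.

(** [P0] and the [P i] are fixed, so only the truncated sections grow with [k], and their growth is
    linear in [expo k]. *)
Let Q_coef : exists D, forall k j, (size ((Q k.+1)`_j)%R <= D * (expo k + 2))%N.
Proof.
have lC (R : {poly {poly F}}) :
    exists D, forall j, (size (R`_j)%R <= D)%N.
  exists (\max_(j < size R) size (R`_j)%R)%N => j.
  have [lt_j|le_j] := ltnP j (size R); last by rewrite nth_default ?size_poly0.
  exact: (@leq_bigmax _ (fun j : 'I_(size R) => size (R`_j)%R) (Ordinal lt_j)).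
rewrite /Q.
have [D0 HD0] := lC P0.
suff [D HD] : exists D, forall k j, (size ((\sum_(i < q | i != 0%N :> nat)
    psect q i k.+1 *: P i)`_j)%R <= D * (expo k + 2))%N.
  exists (D0 + D)%N => k j; rewrite coefD mulnDl.
  apply: leq_trans (size_polyD_leq _ _) (leq_add _ (HD k j)).
  by apply: leq_trans (HD0 j) _; rewrite leq_pmulr ?addn2.
elim: (index_enum _) => [|i r [D IH]].
  by exists 0%N => k j; rewrite big_nil coef0 size_poly0.
have [E HE] := lC (P i); have [S HS] := lbounded_psect F p_gt0 q i.
exists (S + E + D)%N => k j; rewrite big_cons; case: ifP => _; last first.
  by apply: leq_trans (IH k j) _; rewrite leq_mul2r leq_addl orbT.
rewrite coefD coefZ mulnDl.
apply: leq_trans (size_polyD_leq _ _) (leq_add _ (IH k j)).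
apply: leq_trans (size_polyMleq _ _) _; apply: leq_trans (leq_pred _) _.
rewrite mulnDl; apply: leq_add (HS k) _.
by apply: leq_trans (HE j) _; rewrite leq_pmulr ?addn2.
Qed.

(* When the k-th exponent is 0 modulo q, [Q k.+1 = Q k] has coefficients of
   degree too small for its root [psum k.+1]. *)
Let Q_eq0 : exists k0, forall k, (k0 <= k)%N -> logn 2 k.+1 = 0%N ->
  Q k = 0 /\ Q k.+1 = 0.
Proof.
have [k1 Qs] := Q_psum; have [D HD] := Q_coef.
(* Here [k1] serves [Q_psum], [e] serves [Q_recr], and [D] ensures
   [D * (expo k + 2) <= expo k.+1]. *)
exists (k1 + D + e).+1 => -[//|k] le_k r0.
have Qr : Q k.+2 = Q k.+1 by apply: Q_recr; lia.
rewrite Qr; suff -> : Q k.+1 = 0 by [].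
apply: (@root_size_gt _ _ (psum k.+2) (expo k.+1)).
- move=> j; apply: leq_trans (HD k j) _.
  by apply: leq_trans (liouville_exp_growth p_gt0 k); rewrite leq_mul2r; lia.
- by rewrite (size_psumS F p_gt0).
by rewrite -Qr; apply: Qs; lia.
Qed.

(** A large [K] is chosen so that exponent [K] has residue [i] and both neighbours have residue 0.
    By [Q_eq0] at [K.-1] and [K.+1], both [Q K] and [Q K.+1] vanish, and their difference is
    ['X^(expo K) *: P i]. *)
Lemma liouville_independent (i : 'I_q) : i != 0%N :> nat -> P i = 0.
Proof.
move=> i0; have [k0 Q0] := Q_eq0.
(* The second factor is odd, so [logn 2 K.+1 = i], and it is large enough to push [K] beyond
   [k0 + e]. As [i] is positive, [K] and [K.+2] are odd. *)
pose K := (2 ^ i * (k0 + e).+1.*2.+1).-1.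
have K1 : (K.+1 = 2 ^ i * (k0 + e).+1.*2.+1)%N.
  by rewrite prednK // muln_gt0 expn_gt0.
have K0 : logn 2 K = 0%N.
  apply/logn_coprime; rewrite coprime2n -[odd K]negbK -oddS K1 oddM oddX.
  by rewrite (negPf i0).
have K2 : logn 2 K.+2 = 0%N.
  by apply/logn_coprime; rewrite coprime2n oddS K1 oddM oddX (negPf i0).
have le_K : (k0 + e < K)%N.
  have : (1 <= 2 ^ i)%N by rewrite expn_gt0.
  by move: K1; set X := (2 ^ i)%N; nia.
have Ki : (expo K %% q)%N = i.
  rewrite liouville_exp_mod //; last first.
    by apply: leq_trans (ltnW le_K); rewrite leq_addl.
  rewrite K1 lognM ?expn_gt0 // pfactorK // [X in (_ + X)%N]logn_coprime.
    by rewrite addn0 modn_small.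
  by rewrite coprime2n /= odd_double.
have psect_recr j :
    psect q j K.+1 = psect q j K + (if i == j :> nat then 'X^(expo K) else 0).
  by rewrite /liouville_sect big_mkcond big_ord_recr /= -big_mkcond Ki.
have QS : Q K.+1 = Q K + 'X^(expo K) *: P i.
  rewrite /Q -addrA; congr (_ + _).
  rewrite (bigD1 i) //= [in RHS](bigD1 i) //= psect_recr eqxx scalerDl.
  rewrite -!addrA; congr (_ + _); rewrite addrC; congr (_ + _).
  apply: eq_bigr => j /andP[_ /negPf ji].
  by rewrite psect_recr eq_sym [X in if X then _ else _]ji addr0.
have [] := Q0 K.+1 _ K2; first by lia.
have := Q0 K.-1; rewrite QS prednK; last by lia.
move=> /(_ _ K0)[|_ ->]; first by lia.
rewrite add0r => /eqP; rewrite -mul_polyC mulf_eq0 polyC_eq0.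
by rewrite -size_poly_eq0 size_polyXn => /eqP.
Qed.
End Independence.
End Liouville.

(** * Frobenius-linear endomorphisms *)

Section LiouvilleRing.
Variables (F : fieldType) (p : nat).
Local Notation eval := (@liouville_eval F p).
Local Notation t := (fps_t F).

Let evalM A B : eval (A * B) = eval A * eval B.
Proof. exact: (liouville_eval_monoid F p).2. Qed.

Let evalB A B : eval (A - B) = eval A - eval B.
Proof. exact: liouville_eval_zmod. Qed.

(* F(t, f) :&: F[[t]], where f is the Liouville series. *)
Definition liouville_frac : {pred fps F} :=
  fun x => `[< exists A B, eval B <> 0 /\ x * eval B = eval A >].

Lemma liouville_fracP (x : fps F) :
  reflect (exists A B, eval B <> 0 /\ x * eval B = eval A)
          (x \in liouville_frac).
Proof. exact: asboolP. Qed.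

Lemma fps_mul_neq0 (x y : fps F) : x <> 0 -> y <> 0 -> x * y <> 0.
Proof. by move=> x0 y0 /fps_integral[]. Qed.

Fact liouville_frac_closed : subring_closed liouville_frac.
Proof.
split=> [|x y /liouville_fracP[A [B [B0 xB]]] /liouville_fracP[C [D [D0 yD]]]|
          x y /liouville_fracP[A [B [B0 xB]]] /liouville_fracP[C [D [D0 yD]]]].
- apply/liouville_fracP; exists 1, 1; rewrite mul1r rmorph1; split=> //.
  by apply/eqP; rewrite oner_eq0.
- apply/liouville_fracP; exists (A * D - C * B), (B * D).
  rewrite evalM; split; first exact: fps_mul_neq0.
  rewrite evalB (evalM A) (evalM C) -xB -yD mulrBl mulrA; congr (_ - _).
  by rewrite mulrA mulrAC.
apply/liouville_fracP; exists (A * C), (B * D).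
rewrite !evalM -xB -yD; split; first exact: fps_mul_neq0.
by rewrite mulrACA.
Qed.

HB.instance Definition _ :=
  GRing.isSubringClosed.Build (fps F) liouville_frac liouville_frac_closed.

Record liouville_ring := LiouvilleRing {
  liouville_val :> fps F; _ : liouville_val \in liouville_frac }.

HB.instance Definition _ := [isSub for liouville_val].
HB.instance Definition _ := [Choice of liouville_ring by <:].
HB.instance Definition _ :=
  [SubChoice_isSubComNzRing of liouville_ring by <:].

Local Notation R := liouville_ring.
Implicit Types x y : R.

Lemma eval_polyC (P : {poly F}) : eval P%:P = fps_poly P.
Proof. by rewrite /liouville_eval map_polyC hornerC. Qed.

Lemma fps_poly_frac (P : {poly F}) : fps_poly P \in liouville_frac.
Proof.
apply/liouville_fracP; exists P%:P, 1; rewrite rmorph1 mulr1 eval_polyC.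
by split=> //; apply/eqP; rewrite oner_eq0.
Qed.

Lemma liouville_in_frac : liouville F p \in liouville_frac.
Proof.
apply/liouville_fracP; exists 'X, 1; rewrite rmorph1 mulr1.
split; first by apply/eqP; rewrite oner_eq0.
by rewrite /liouville_eval map_polyX hornerX.
Qed.

Lemma fps_tX_neq0 n : t ^+ n <> 0.
Proof.
rewrite fps_tXE => /fpsP/(_ n)/eqP.
by rewrite /= coefXn eqxx oner_eq0.
Qed.

Lemma liouville_frac_div n (x : fps F) :
  t ^+ n * x \in liouville_frac -> x \in liouville_frac.
Proof.
case/liouville_fracP => A [B [B0 xB]]; apply/liouville_fracP.
exists A, ('X^n%:P * B); rewrite evalM eval_polyC -fps_tXE -xB.
by split; [apply/fps_mul_neq0/B0/fps_tX_neq0 | rewrite mulrCA mulrA].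
Qed.

Lemma liouville_frac_inv (u v : fps F) :
  u * v = 1 -> u \in liouville_frac -> v \in liouville_frac.
Proof.
move=> uv /liouville_fracP[A [B [B0 uB]]]; apply/liouville_fracP.
exists B, A; rewrite -uB mulrA [v * u]mulrC uv mul1r; split=> // uB0.
by apply: B0; rewrite -[eval B]mul1r -uv mulrAC uB0 mul0r.
Qed.

Definition lr_poly (P : {poly F}) : R := LiouvilleRing (fps_poly_frac P).
Definition lr_t : R := lr_poly 'X.
Definition lr_f : R := LiouvilleRing liouville_in_frac.

Lemma lr_valM x y : val (x * y) = val x * val y. Proof. by []. Qed.
Lemma lr_valD x y : val (x + y) = val x + val y. Proof. by []. Qed.

Lemma lr_integral x y : x * y = 0 -> x = 0 \/ y = 0.
Proof.
move/(congr1 val); rewrite lr_valM => /fps_integral[x0|y0]; [left|right];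
  exact: val_inj.
Qed.

Lemma lr_val_tX n : val (lr_t ^+ n) = t ^+ n.
Proof. exact: rmorphXn. Qed.

Lemma lr_poly0 : lr_poly 0 = 0 :> R.
Proof. by apply: val_inj; apply/fpsP => n /=; rewrite coef0. Qed.

Lemma lr_polyD P Q : lr_poly (P + Q) = lr_poly P + lr_poly Q.
Proof. by apply: val_inj; apply/fpsP => n; rewrite /= coefD. Qed.

Lemma lr_polyXn n : lr_poly 'X^n = lr_t ^+ n.
Proof. by apply: val_inj; rewrite lr_val_tX /= fps_tXE. Qed.

(** The factorization in [fps F] descends to R, because R is stable under exact division by powers
    of t and under inverses of units of [fps F]. *)
Lemma lr_factor x : x != 0 ->
  exists n u v, x = lr_t ^+ n * u /\ u * v = 1.
Proof.
move=> x0; have /fps_factor[n [u [xu /fps_inv[v uv]]]] : val x != 0.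
  by apply: contraNneq x0 => x0; apply/eqP/val_inj.
have uS : u \in liouville_frac.
  by apply: (@liouville_frac_div n); rewrite -xu; apply: valP.
exists n, (LiouvilleRing uS), (LiouvilleRing (liouville_frac_inv uv uS)).
by split; apply: val_inj; rewrite lr_valM // lr_val_tX.
Qed.

Lemma lr_t_neq0 : lr_t != 0.
Proof.
by apply/eqP => t0; apply: (@fps_tX_neq0 1); rewrite -(lr_val_tX 1) expr1 t0.
Qed.

Lemma lr_t_nonunit x : lr_t * x != 1.
Proof.
rewrite -[lr_t]expr1; apply/eqP => /(congr1 val).
rewrite lr_valM lr_val_tX => /fpsP/(_ 0%N)/eqP.
by rewrite coef_tXM eq_sym oner_eq0.
Qed.

(** Polynomials are t-adically dense in R, with a cofactor [y] that lies in R itself, so that phi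
    can be applied to it. *)
Lemma lr_approx n x :
  exists y, x = lr_poly (fps_trunc n (val x)) + lr_t ^+ n * y.
Proof.
have [z xz] := eqmod_div_tX (eqmod_sym (@eqmod_fps_trunc _ n (val x))).
have zS : z \in liouville_frac.
  apply: (@liouville_frac_div n).
  have -> : t ^+ n * z = val (x - lr_poly (fps_trunc n (val x))).
    by rewrite rmorphB /= {1}xz addrC addKr.
  exact: valP.
by exists (LiouvilleRing zS); apply: val_inj; rewrite lr_valD lr_valM lr_val_tX.
Qed.

(** Clearing denominators reduces this to [liouville_independent]. *)
Lemma lr_independent (e : nat) (c : R) (h : 'I_(p ^ e) -> R) : prime p ->
    val c + \sum_(i < p ^ e | i != 0%N :> nat)
      val (h i) * fps_sect (p ^ e) i (liouville F p) = 0 ->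
  forall i : 'I_(p ^ e), i != 0%N :> nat -> h i = 0.
Proof.
move=> p_pr rel.
have [A0 [B0 [nzB0 cB]]] := liouville_fracP _ (valP c).
have /choice[AB hAB] : forall i, exists AB : {poly {poly F}} * {poly {poly F}},
    eval AB.2 <> 0 /\ val (h i) * eval AB.2 = eval AB.1.
  move=> i; have [A [B hAB]] := liouville_fracP _ (valP (h i)).
  by exists (A, B).
(* The common denominator is [B0 * D]; since [D' i] omits the denominator of [h i], the numerator of
   [h i] over it is [B0 * (AB i).1 * D' i]. *)
pose D := \prod_i (AB i).2; pose D' i := \prod_(j | j != i) (AB j).2.
have DE i : D = (AB i).2 * D' i by rewrite /D (bigD1 i).
have nzD : eval D <> 0.
  rewrite rmorph_prod; apply: (big_ind (fun x : fps F => x <> 0)).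
  - by apply/eqP; rewrite oner_eq0.
  - exact: fps_mul_neq0.
  by move=> i _; have [] := hAB i.
have hE i : eval (B0 * (AB i).1 * D' i) = eval (B0 * D) * val (h i).
  have [_ hi] := hAB i; rewrite !evalM -hi (DE i) evalM.
  by rewrite -!mulrA; congr (_ * _); rewrite mulrC -!mulrA; congr (_ * _);
     rewrite mulrC.
move=> i i0; have Pi0 : B0 * (AB i).1 * D' i = 0.
  apply: (@liouville_independent F p p_pr e (A0 * D)
    (fun i => B0 * (AB i).1 * D' i)) => //.
  have := congr1 ( *%R (eval (B0 * D))) rel.
  rewrite mulr0 mulrDr mulr_sumr; apply: etrans; congr (_ + _).
    by rewrite !evalM -cB -mulrA mulrC.
  by apply: eq_bigr => j _; rewrite hE mulrA.
have := hE i; rewrite Pi0 rmorph0 => /esym/fps_integral[]; last first.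
  by move=> h0; apply: val_inj.
by rewrite evalM => /fps_mul_neq0; case.
Qed.

End LiouvilleRing.

(** * R^q-linear maps are multiplications *)

Section FrobeniusEndomorphism.
Variables (p e : nat).
Hypothesis p_pr : prime p.
Local Notation q := (p ^ e)%N.
Local Notation R := (liouville_ring 'F_p p).
Local Notation t := (fps_t 'F_p).
Local Notation sect := (fps_sect q).
Let q_gt0 : (0 < q)%N. Proof. by rewrite expn_gt0 prime_gt0. Qed.

Variable phi : R -> R.
Hypothesis phiD : forall x y : R, phi (x + y) = phi x + phi y.
Hypothesis phiZ : forall r x : R, phi (r ^+ q * x) = r ^+ q * phi x.

Let phi0 : phi 0 = 0.
Proof. by apply: (addrI (phi 0)); rewrite -phiD !addr0. Qed.

Let g (i : nat) : fps 'F_p := val (phi (lr_t _ _ ^+ i)).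

(* The factor t^(q-1) clears the denominators in
   phi(x) = sum_i t^(-i) sect_i(x) phi(t^i). *)
Let expands (x : R) : Prop :=
  t ^+ q.-1 * val (phi x) =
  \sum_(i < q) t ^+ (q.-1 - i) * sect i (val x) * g i.

Let expands0 : expands 0.
Proof.
rewrite /expands phi0 mulr0 big1 // => i _.
suff -> : sect i (val (0 : R)) = 0 by rewrite mulr0 mul0r.
by apply/fpsP => n /=; case: ifP.
Qed.

Let expandsD x y : expands x -> expands y -> expands (x + y).
Proof.
rewrite /expands phiD !lr_valD mulrDr => -> ->; rewrite -big_split /=.
by apply: eq_bigr => i _; rewrite fps_sectD mulrDr mulrDl.
Qed.

(** Only the section of index [n %% q] is nonzero, and the remaining factor of t^n is a q-th power,
    which phi lets through. *)
Let expandsXn n : expands (lr_t _ _ ^+ n).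
Proof.
rewrite /expands (bigD1 (Ordinal (ltn_pmod n q_gt0))) //= big1 ?addr0.
  have sectE : sect (n %% q)%N (val (lr_t 'F_p p ^+ n)) = t ^+ n.
    apply/fpsP => m; rewrite lr_val_tX fps_tXE /= coefXn.
    by case: eqP => // nm; case: eqP => // mn; rewrite mn in nm.
  rewrite sectE {1}(divn_eq n q) exprD exprM phiZ lr_valM -exprM lr_val_tX.
  rewrite -/(g _).
  rewrite !mulrA -!exprD; congr (_ * _); congr (_ ^+ _).
  have := ltn_pmod n q_gt0; have := divn_eq n q; lia.
move=> i; rewrite -val_eqE /= => /negPf ni.
suff -> : sect i (val (lr_t 'F_p p ^+ n)) = 0 by rewrite mulr0 mul0r.
apply/fpsP => m; rewrite lr_val_tX fps_tXE /= coefXn.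
by case: eqP => // mi; case: eqP => // mn; rewrite -mi mn eqxx in ni.
Qed.

Let expands_poly (P : {poly 'F_p}) : expands (lr_poly p P).
Proof.
rewrite -[P]coefK poly_def.
apply: (big_ind (fun A => expands (lr_poly p A))) => [|A B|i _].
- by rewrite lr_poly0.
- by rewrite lr_polyD; apply: expandsD.
(* Constants of 'F_p are multiples of 1 by natural numbers, so additivity of phi handles them. *)
move: P`_i => c; have -> : c *: 'X^i = 'X^i *+ c.
  by rewrite -[in LHS](natr_Zp c) scaler_nat.
elim: (c : nat) => [|n IH].
  by rewrite lr_poly0.
by rewrite mulrS lr_polyD lr_polyXn; apply: expandsD.
Qed.

(** This is t-adic continuity: t^(nq) is a q-th power, so phi maps t^(nq) R into itself, and [x] may
    be replaced by a polynomial modulo t^(nq). *)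
Let expands_all (x : R) : expands x.
Proof.
apply: eqmod_eq => n; apply: (@eqmodW _ n (n * q)); first by rewrite leq_pmulr.
have [y xE] := lr_approx (n * q) x; set P := fps_trunc _ _ in xE.
rewrite {1}xE phiD exprM phiZ -exprM lr_valD lr_valM lr_val_tX mulrDr.
rewrite (expands_poly P) -[X in eqmod _ _ X]addr0; apply: eqmodD.
  apply: eqmod_sum => i; apply: eqmodM => //; apply: eqmodM => //.
  exact/eqmod_sect/eqmod_fps_trunc.
by rewrite mulrCA; apply: eqmod_tXM.
Qed.

(** Subtracting t^(q-1) phi(1) f, with f written as the sum of its sections, from the expansion of
    phi(f) gives a linear relation between 1 and these sections. Its coefficients [c] and [h] lie in
    R, so [lr_independent] applies; [h 0] is zero at once. *)
Let g_eq (i : 'I_q) : t ^+ (q.-1 - i) * g i = t ^+ q.-1 * g 0.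
Proof.
have [i0|i0] := eqVneq (i : nat) 0%N; first by rewrite i0 subn0.
pose f := lr_f 'F_p p; pose T := lr_t 'F_p p.
pose h (j : 'I_q) : R :=
  T ^+ (q.-1 - j) * phi (T ^+ j) - T ^+ q.-1 * phi (T ^+ 0).
pose c : R := T ^+ q.-1 * (phi (T ^+ 0) * f - phi f).
have valB x y : val (x - y : R) = val x - val y by [].
have hE j : val (h j) = t ^+ (q.-1 - j) * g j - t ^+ q.-1 * g 0.
  by rewrite valB !lr_valM !lr_val_tX.
apply/eqP; rewrite -subr_eq0 -hE (_ : h i = 0) //.
apply: (@lr_independent _ p e c h) => //.
have Ef := expands_all f; rewrite /expands in Ef.
rewrite lr_valM lr_val_tX valB lr_valM mulrBr Ef.
rewrite -/(g 0) -{1}(sum_fps_sect (val f) q_gt0).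
rewrite -[val f]/(liouville 'F_p p).
under [X in _ + X]eq_bigr => j _ do rewrite hE.
rewrite !mulr_sumr -sumrB [X in _ + X]big_mkcond -big_split big1 // => j _ /=.
by case: eqVneq => [->|_] /=; rewrite ?subn0; ring.
Qed.

Lemma liouville_frobenius_endomorphism (x : R) : phi x = phi 1 * x.
Proof.
apply: val_inj; apply: (@tX_inj _ q.-1); rewrite (expands_all x) lr_valM.
transitivity (\sum_(i < q) t ^+ q.-1 * g 0 * sect i (val x)).
  by apply: eq_bigr => i _; rewrite mulrAC g_eq.
by rewrite -mulr_sumr (sum_fps_sect _ q_gt0) mulrA.
Qed.

End FrobeniusEndomorphism.

(** * Indecomposability and the theorem *)

Lemma liouville_frobenius_indecomposable (p : nat) (p_pr : prime p)
    (chRp : p \in [pchar (liouville_ring 'F_p p)]) (e : nat) :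
  indecomposable (frobenius_pushforward chRp e).
Proof.
set V := frobenius_pushforward chRp e.
split=> [|U W [U0 Ulin] [W0 Wlin] sumUW disjUW].
  by exists (1 : liouville_ring 'F_p p); apply: oner_neq0.
(* [pi] is the projection onto [U] along [W]. *)
have /choice[pi piP] : forall v : V, exists u : V, u \in U /\ v - u \in W.
  move=> v; have [u [w [uU wW ->]]] := sumUW v.
  by exists u; rewrite addrC addKr.
have UD u v : u \in U -> v \in U -> u + v \in U.
  by move=> uU vU; have := Ulin 1 u v uU vU; rewrite scale1r.
have WD u v : u \in W -> v \in W -> u + v \in W.
  by move=> uU vU; have := Wlin 1 u v uU vU; rewrite scale1r.
have UZ r u : u \in U -> r *: u \in U.
  by move=> uU; have := Ulin r u 0 uU U0; rewrite addr0.
have WZ r u : u \in W -> r *: u \in W.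
  by move=> uU; have := Wlin r u 0 uU W0; rewrite addr0.
have pi_uniq v u : u \in U -> v - u \in W -> pi v = u.
  move=> uU vuW; have [piU piW] := piP v; apply/eqP; rewrite -subr_eq0.
  apply/eqP/disjUW; first by rewrite -scaleN1r UD ?UZ.
  have -> : pi v - u = (v - u) + (-1) *: (v - pi v).
    by rewrite scaleN1r opprB [RHS]addrC addrA subrK.
  by rewrite WD ?WZ.
have piD x y : pi (x + y) = pi x + pi y.
  have [xU xW] := piP x; have [yU yW] := piP y.
  by apply: pi_uniq; [apply: UD | rewrite opprD addrACA WD].
have piZ r x : pi (r *: x) = r *: pi x.
  have [xU xW] := piP x.
  by apply: pi_uniq; [apply: UZ | rewrite -scalerBr WZ].
(* Scalars act on [V] through their q-th powers, so [piZ] is R^q-linearity up to conversion. *)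
have piE := @liouville_frobenius_endomorphism p e p_pr pi piD piZ.
have pi1_idem : pi (pi 1 : V) = pi (1 : V).
  by apply: pi_uniq; [have [] := piP 1 | rewrite subrr].
have piU u : u \in U -> pi u = u by move=> uU; apply: pi_uniq; rewrite ?subrr.
have piW w : w \in W -> pi w = 0 by move=> wW; apply: pi_uniq; rewrite ?subr0.
(* Since [pi] is multiplication by [pi 1], this element is idempotent in a domain: the value 0 kills
   [U] and the value 1 kills [W]. *)
have : pi 1 * (pi 1 - 1) = 0 :> liouville_ring 'F_p p.
  by rewrite mulrBr -piE pi1_idem mulr1 subrr.
case/lr_integral => [a0|a1]; [left|right].
  by move=> u /piU <-; rewrite piE a0 mul0r.
move=> w /piW; rewrite piE; move/eqP: a1; rewrite subr_eq0 => /eqP->.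
by rewrite mul1r.
Qed.

Lemma pchar_liouville_ring (p : nat) : prime p ->
  p \in [pchar (liouville_ring 'F_p p)].
Proof.
move=> p_pr; apply/andP; split=> //; apply/eqP.
have lr_polyMn n : lr_poly p (n%:R : {poly 'F_p}) = n%:R.
  elim: n => [|n IH]; first exact: lr_poly0.
  rewrite !mulrS lr_polyD IH; congr (_ + _).
  by rewrite -(expr0 'X) lr_polyXn expr0.
rewrite -lr_polyMn -polyC_natr (pcharf0 (pchar_Fp p_pr)) polyC0.
exact: lr_poly0.
Qed.

Theorem theorem1p2 : forall p : nat, prime p ->
  exists (R : comNzRingType) (chRp : p \in [pchar R]),
    [/\ regular_local_ring R,
        (exists d : nat, krull_dim R d /\ (0 < d)%N)
      & forall e : nat, indecomposable (frobenius_pushforward chRp e)].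
Proof.
move=> p p_pr; exists (liouville_ring 'F_p p), (pchar_liouville_ring p_pr).
split; last exact: liouville_frobenius_indecomposable.
- exact: (dvr_regular_local (@lr_integral _ _) (lr_t_neq0 _ _)
    (@lr_t_nonunit _ _) (@lr_factor _ _)).
exists 1%N; split=> //.
exact: (dvr_krull_dim (@lr_integral _ _) (lr_t_neq0 _ _)
  (@lr_t_nonunit _ _) (@lr_factor _ _)).
Qed.
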